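(* (Odd stencil.) Let $M$ be odd, $A=-B$, and let $\widetilde H(\mathbf U)$ be a semidiscretization of the Hamiltonian on the stencil. Consider the AVF method $$D_n\mathbf u_{0,0}=\widetilde{\mathcal D}(\mathbf u_0,\mathbf u_1)\,\widetilde\delta(\mathbf u_0,\mathbf u_1),\qquad \widetilde\delta(\mathbf u_0,\mathbf u_1)=\int_0^1\mathsf E_{\mathbf U}\bigl(\widetilde H(\mathbf U)\bigr)\Big|_{\mathbf U=(1-\xi)\mathbf u_0+\xi\mathbf u_1}\,\mathrm d\xi. \tag{O}$$ If there exists a function $f$ defined on the stencil such that $$\widetilde\delta(\mathbf u_0,\mathbf u_1)^T\,\widetilde{\mathcal D}(\mathbf u_0,\mathbf u_1)\,\widetilde\delta(\mathbf u_0,\mathbf u_1)=D_m(f),$$ then (O) preserves a discrete energy conservation law: there is a function $\widetilde F$ defined on the stencil such that all solutions of (O) satisfy $D_n\widetilde H(\mathbf u_0)=D_m(\widetilde F)$. (Even stencil.) Let $M$ be even, $A=1-B$, and let $\widetilde H(\mu_m\mathbf U)$ be a semidiscretization of the Hamiltonian on the stencil. Consider the AVF method $$D_n\mu_m\mathbf u_{0,0}=\widetilde{\mathcal D}(\mathbf u_0,\mathbf u_1)\,\widetilde\delta(\mu_m\mathbf u_0,\mu_m\mathbf u_1),\qquad \widetilde\delta(\mu_m\mathbf u_0,\mu_m\mathbf u_1)=\int_0^1\mathsf E_{\mu_m\mathbf U}\bigl(\widetilde H(\mu_m\mathbf U)\bigr)\Big|_{\mathbf U=(1-\xi)\mathbf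 u_0+\xi\mathbf u_1}\,\mathrm d\xi. \tag{E}$$ If there exists a function $f$ defined on the stencil such that $$\widetilde\delta(\mu_m\mathbf u_0,\mu_m\mathbf u_1)^T\,\widetilde{\mathcal D}(\mathbf u_0,\mathbf u_1)\,\widetilde\delta(\mu_m\mathbf u_0,\mu_m\mathbf u_1)=D_m(f),$$ then (E) preserves a discrete energy conservation law: there is a function $\widetilde F$ defined on the stencil such that all solutions of (E) satisfy $D_n\widetilde H(\mu_m\mathbf u_0)=D_m(\widetilde F)$.
   Context: Background: the methods approximate a Hamiltonian PDE system $D_t\mathbf u=\mathcal D([\mathbf u]_x)\,\mathcal E(H([\mathbf u]_x))$ for $\mathbf u=(u^1,\dots,u^q)$, where $[\mathbf u]_x$ denotes $\mathbf u$ and finitely many of its $x$-derivatives, $\mathcal E$ is the Euler operator (variational derivative), and $\mathcal D$ is a skew-adjoint operator satisfying the Jacobi identity. Periodic boundary conditions are used only for simplicity; the result is local. Grid. Fix $\Delta x,\Delta t>0$ and a uniform spatial grid indexed by integers (or integers modulo the period). There are two time levels $n=0,1$, and $u_{m,n}^\alpha$ denotes the approximation at the node with index $m$ relative to a generic grid point (index $0$) and time level $n$, $\alpha=1,\dots,q$; $\mathbf u_{m,n}=(u_{m,n}^1,\dots,u_{m,n}^q)^T$, and $\mathbf u_n$ denotes the collection of the values at time level $n$. The stencil nodes have $m=A,\dots,B$, $M=B-A+1$. Every equation and expression is written at the generic grid point and is understood at every grid point by shifting. $S_m$ is the forward shift in space (index $m\mapsto m+1$ in all arguments), $D_m=\frac1{\Delta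 x}(S_m-I)$, $\mu_m=\frac12(S_m+I)$; $D_n$ is the forward difference in time, so $D_n\mathbf u_{0,0}=(\mathbf u_{0,1}-\mathbf u_{0,0})/\Delta t$ and $D_n\widetilde H(\mathbf u_0)=(\widetilde H(\mathbf u_1)-\widetilde H(\mathbf u_0))/\Delta t$ (similarly $D_n\widetilde H(\mu_m\mathbf u_0)=(\widetilde H(\mu_m\mathbf u_1)-\widetilde H(\mu_m\mathbf u_0))/\Delta t$). ''Function defined on the stencil'' ($f$, $\widetilde F$): a fixed function of the values of $\mathbf u_0$ and $\mathbf u_1$ at finitely many nodes around the generic grid point; the node set is fixed (independent of the grid point). The hypothesis on $f$ is an identity at every grid point, for all $\mathbf u_0,\mathbf u_1$. $\widetilde H$ is a continuously differentiable function of finitely many grid values: in the odd case of $U_i^\alpha$, $i=A,\dots,B$; in the even case of $W_i^\alpha=\mu_mU_i^\alpha=\frac12(U_i^\alpha+U_{i+1}^\alpha)$, $i=A,\dots,B-1$. The Euler operators are the column vectors with $\alpha$-th entries $$(\mathsf E_{\mathbf U}(\widetilde H(\mathbf U)))_\alpha=\sum_iS_m^{-i}\frac{\partial\widetilde H(\mathbf U)}{\partial U_i^\alpha},\qquad (\mathsf E_{\mu_m\mathbf U}(\widetilde H(\mu_m\mathbf U)))_\alpha=\sum_iS_m^{-i}\frac{\partial\widetilde H(\mathbf W)}{\partial W_i^\alpha}\Big|_{\mathbf W=\mu_m\mathbf U}.$$ Thus $\widetilde\delta$ is an $\mathbb R^q$-valued grid function. $\widetilde{\mathcal D}(\mathbf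 u_0,\mathbf u_1)$ is a discretization of $\mathcal D$: a $q\times q$ matrix of linear operators on scalar grid functions, possibly depending on $\mathbf u_0,\mathbf u_1$; no skew-adjointness of $\widetilde{\mathcal D}$ is assumed. $\widetilde\delta^T\widetilde{\mathcal D}\widetilde\delta$ is the scalar grid function obtained as the pointwise inner product in $\mathbb R^q$ of $\widetilde\delta$ and $\widetilde{\mathcal D}\widetilde\delta$. *)

(* Defs.v *)
From HB Require Import structures.
From mathcomp Require Import all_boot all_order all_algebra.
From mathcomp Require Import all_classical all_reals all_analysis.

Set Implicit Arguments.
Unset Strict Implicit.
Unset Printing Implicit Defensive.

Import Order.TTheory GRing.Theory Num.Theory.
Import numFieldNormedType.Exports.

Local Open Scope classical_set_scope.
Local Open Scope ring_scope.

(* The nodes of a uniform grid form a cyclic group generated by e, and the node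
   following g is g + e: the nodes are indexed by the integers if e has infinite
   order, and by the integers modulo P if e has order P (periodic boundary
   conditions).  Grid functions are functions on G. *)
Definition uniform_grid (G : zmodType) (e : G) : Prop :=
  forall g : G, exists k : int, g = e *~ k.

Section GridOperators.
Variables (R : realType) (G : zmodType) (e : G).

(* shift e k is S_m^k, for k of either sign. *)
Definition shift (V : Type) (k : int) (phi : G -> V) : G -> V :=
  fun g => phi (g + e *~ k).

Definition Dm (dx : R) (phi : G -> R) : G -> R :=
  fun g => (shift 1 phi g - phi g) / dx.

Definition mum (V : lmodType R) (phi : G -> V) : G -> V :=
  fun g => 2^-1 *: (shift 1 phi g + phi g).

(* phi0 and phi1 are the values at time levels 0 and 1. *)
Definition Dn (dt : R) (V : lmodType R) (phi0 phi1 : G -> V) : G -> V :=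
  fun g => dt^-1 *: (phi1 g - phi0 g).

Variable q : nat.

(* Column j holds the value of u at the node of index (nodes j) relative
   to g. *)
Definition node_values (k : nat) (nodes : 'I_k -> int) (u : G -> 'cV[R]_q) :
    G -> 'M[R]_(q, k) :=
  fun g => \matrix_(a < q, j < k) shift (nodes j) u g a 0.

(* Nodes A, A + 1, ..., A + N - 1. *)
Definition window (A : int) (N : nat) (u : G -> 'cV[R]_q) : G -> 'M[R]_(q, N) :=
  node_values (fun i : 'I_N => A + i%:Z) u.

End GridOperators.

(* A fixed function of the values of u_0 and u_1 at finitely many nodes around
   the generic grid point. *)
Record stencil_function (R : realType) (q : nat) := StencilFunction {
  node_count : nat;
  node : 'I_node_count -> int;
  rule : 'M[R]_(q, node_count) -> 'M[R]_(q, node_count) -> R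
}.

Definition stencil_eval (R : realType) (G : zmodType) (e : G) (q : nat)
    (f : stencil_function R q) (u0 u1 : G -> 'cV[R]_q) : G -> R :=
  fun g => rule (node_values e (node (s := f)) u0 g)
                (node_values e (node (s := f)) u1 g).

Section AVF.
Variables (R : realType) (G : zmodType) (e : G) (q : nat).

Definition partial (N : nat) (H : 'M[R]_(q, N) -> R) (a : 'I_q) (i : 'I_N)
    (X : 'M[R]_(q, N)) : R :=
  'D_(delta_mx a i) H X.

Definition continuously_differentiable (N : nat) (H : 'M[R]_(q, N) -> R) :
    Prop :=
  (forall X, differentiable H X) /\ (forall a i, continuous (partial H a i)).

(* The i-th argument of H is the value at relative index A + i, whence the
   shift by - (A + i).  With V = U this is E_U(H(U)); with V = mu_m U and H
   taken as a function of the averages W it is E_{mu_m U}(H(mu_m U)). *)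
Definition euler (A : int) (N : nat) (H : 'M[R]_(q, N) -> R)
    (V : G -> 'cV[R]_q) : G -> 'cV[R]_q :=
  fun g => \col_(a < q) \sum_(i < N)
    shift e (- (A + i%:Z)) (fun g' => partial H a i (window e A N V g')) g.

Definition segment (u0 u1 : G -> 'cV[R]_q) (xi : R) : G -> 'cV[R]_q :=
  fun g => (1 - xi) *: u0 g + xi *: u1 g.

Definition delta_odd (A : int) (N : nat) (H : 'M[R]_(q, N) -> R)
    (u0 u1 : G -> 'cV[R]_q) : G -> 'cV[R]_q :=
  fun g => \col_(a < q) \int[lebesgue_measure]_(xi in `[0, 1])
    euler A H (segment u0 u1 xi) g a 0.

Definition delta_even (A : int) (N : nat) (H : 'M[R]_(q, N) -> R)
    (u0 u1 : G -> 'cV[R]_q) : G -> 'cV[R]_q :=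
  fun g => \col_(a < q) \int[lebesgue_measure]_(xi in `[0, 1])
    euler A H (mum e (segment u0 u1 xi)) g a 0.

Definition operator_matrix : Type :=
  'I_q -> 'I_q -> {linear (G -> R) -> (G -> R)}.

Definition apply_op (D : operator_matrix) (v : G -> 'cV[R]_q) :
    G -> 'cV[R]_q :=
  fun g => \col_(a < q) \sum_(b < q) D a b (fun g' => v g' b 0) g.

(* The scalar grid function v^T D v. *)
Definition quad_op (D : operator_matrix) (v : G -> 'cV[R]_q) : G -> R :=
  fun g => ((v g)^T *m apply_op D v g) 0 0.

End AVF.

(* Main.v *)
(* By the fundamental theorem of calculus along the segment from u_0 to u_1,
   H(u_1) - H(u_0) at a grid point is the sum over (a, i) of the mean of the
   partial derivative of H times the increment of u^a at the node A + i.
   Shifting each term back by A + i turns the sum into delta^T (u_1 - u_0),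
   and S_m^k - I is S_m - I composed with a finite sum of shifts, so the error
   is D_m of a function of finitely many nodes.  On solutions
   delta^T (u_1 - u_0) / dt = delta^T D delta = D_m f.  In the even case the
   same identity is applied to mu_m u. *)

Require Import Defs.
From HB Require Import structures.
From mathcomp Require Import all_boot all_order all_algebra.
From mathcomp Require Import all_classical all_reals all_analysis.
From mathcomp Require Import zify ring.

Set Implicit Arguments.
Unset Strict Implicit.
Unset Printing Implicit Defensive.

Import Order.TTheory GRing.Theory Num.Theory.
Import numFieldNormedType.Exports.

Local Open Scope classical_set_scope.
Local Open Scope ring_scope.

(* all_analysis exports another shift, which shadows the grid shift. *)
Local Notation shift := Defs.shift.

(** * Fundamental theorem of calculus along a segment of stencil values *)

Section Analysis.
Variable R : realType.
Local Notation mu := (@lebesgue_measure R).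

Lemma continuous_sum (I : Type) (r : seq I) (F : I -> R -> R) :
  (forall i, continuous (F i)) -> continuous (fun x => \sum_(i <- r) F i x).
Proof.
by move=> cF; apply: continuous_big => [|i _]; [exact: add_continuous | exact: cF].
Qed.

Lemma continuous_integrable01 (f : R -> R) :
  continuous f -> mu.-integrable `[0, 1] (EFin \o f).
Proof.
move=> cf; apply: continuous_compact_integrable; first exact: segment_compact.
exact: continuous_subspaceT.
Qed.

Lemma Rintegral01_sum (I : Type) (r : seq I) (F : I -> R -> R) :
  (forall i, continuous (F i)) ->
  \int[mu]_(x in `[0, 1]) (\sum_(i <- r) F i x)
  = \sum_(i <- r) \int[mu]_(x in `[0, 1]) F i x.
Proof.
move=> cF; elim: r => [|i r IHr].
  under eq_Rintegral do rewrite big_nil.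
  by rewrite big_nil Rintegral_cst// mul0r.
under eq_Rintegral do rewrite big_cons.
rewrite big_cons RintegralD// ?IHr//; apply: continuous_integrable01 => //.
exact: continuous_sum.
Qed.

Lemma Rintegral01_FTC (f F : R -> R) :
  continuous f -> (forall x, derivable F x 1) -> F^`()%classic =1 f ->
  \int[mu]_(x in `[0, 1]) f x = F 1 - F 0.
Proof.
move=> cf dF F'f; rewrite /Rintegral (@continuous_FTC2 _ f F)//.
  exact: continuous_subspaceT.
(* Derivability on the whole line supplies the one-sided continuity at the endpoints [0] and [1]. *)
have cF x : {for x, continuous F}.
  by apply: differentiable_continuous; apply/derivable1_diffP.
split=> [x _ | |]; first exact: dF.
  by apply: cvg_at_right_filter; exact: cF.
by apply: cvg_at_left_filter; exact: cF.
Qed.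

Variables (q N : nat).
Implicit Types X Y : 'M[R]_(q, N).

Lemma differentiable_line X Y (x : R) :
  is_diff x (fun t : R => (1 - t) *: X + t *: Y : 'M[R]_(q, N))
            (fun t => t *: (Y - X)).
Proof.
have -> : (fun t : R => (1 - t) *: X + t *: Y)
    = cst X + ( *:%R^~ (Y - X)).
  apply/funext => t; rewrite !fctE/= scalerBl scale1r scalerBr.
  by rewrite addrAC addrA.
have := is_diffD (@is_diff_cst R R^o 'M[R]_(q, N) X x)
  (@is_diff_scalel R 'M[R]_(q, N) x (Y - X)).
by rewrite add0r.
Qed.

Lemma continuous_line X Y :
  continuous (fun t : R => (1 - t) *: X + t *: Y : 'M[R]_(q, N)).
Proof.
by move=> x; apply: differentiable_continuous; case: (differentiable_line X Y x).
Qed.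

Lemma continuous_partial_line (H : 'M[R]_(q, N) -> R) X Y a i :
  continuously_differentiable H ->
  continuous (fun x : R => partial H a i ((1 - x) *: X + x *: Y)).
Proof.
move=> [_ cH] x; apply: continuous_comp; first exact: continuous_line.
exact: cH.
Qed.

(** The chain rule differentiates [H] along the segment. The velocity [X1 - X0] is constant, so its
    entries come out of the integrals. *)
Lemma partial_line_integral (H : 'M[R]_(q, N) -> R) X0 X1 :
  continuously_differentiable H ->
  H X1 - H X0 = \sum_a \sum_i (X1 a i - X0 a i) *
    \int[mu]_(x in `[0, 1]) partial H a i ((1 - x) *: X0 + x *: X1).
Proof.
move=> H_C1; have [dH _] := H_C1.
pose line x : 'M[R]_(q, N) := (1 - x) *: X0 + x *: X1.
have cp a i : continuous (fun x => partial H a i (line x)).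
  exact: continuous_partial_line.
have cpM a i : continuous (fun x => (X1 a i - X0 a i) * partial H a i (line x)).
  by move=> x; apply: cvgMr; exact: cp.
have cpS a : continuous
    (fun x => \sum_i (X1 a i - X0 a i) * partial H a i (line x)).
  by apply: continuous_sum => i; exact: cpM.
have lineD x : is_diff x line ( *:%R^~ (X1 - X0)) by exact: differentiable_line.
have dl x : differentiable line x by case: (lineD x).
have dHl x : differentiable (H \o line) x by exact: differentiable_comp.
transitivity (\int[mu]_(x in `[0, 1])
    (\sum_a \sum_i (X1 a i - X0 a i) * partial H a i (line x))).
  rewrite (@Rintegral01_FTC _ (H \o line)).
  - by rewrite /line/= subrr scale0r add0r scale1r subr0 scale1r scale0r addr0.
  - by apply: continuous_sum => a; exact: cpS.
  - by move=> x; apply/derivable1_diffP.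
  - move=> x; rewrite derive1E'; last exact: dHl.
    rewrite (diff_comp (dl x) (dH _))/=.
    rewrite (@diff_val _ _ _ _ _ _ _ (lineD x)) scale1r.
    (* Expanding the velocity in the matrix units [delta_mx a i] turns the differential of [H] into
       a combination of its partial derivatives. *)
    rewrite [X in 'd _ _ X]matrix_sum_delta !linear_sum/=.
    apply: eq_bigr => a _; rewrite linear_sum; apply: eq_bigr => i _.
    by rewrite linearZ/= /partial deriveE// !mxE.
rewrite Rintegral01_sum//; apply: eq_bigr => a _.
rewrite Rintegral01_sum//; apply: eq_bigr => i _.
by rewrite RintegralZl//; apply: continuous_integrable01.
Qed.

End Analysis.

(** * Functionals of finitely many nodes, and telescoping of shifts *)

Section Local.
Variables (R : realType) (G : zmodType) (e : G) (q : nat).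
Local Notation functional := ((G -> 'cV[R]_q) -> (G -> 'cV[R]_q) -> G -> R).
Implicit Types (Phi Psi : functional) (u v : G -> 'cV[R]_q) (g h : G).

Definition agree (L : nat) u g v h :=
  forall k : int, (`|k| <= L)%N -> u (g + e *~ k) = v (h + e *~ k).

(** Comparing two base points [g] and [h] encodes, besides the dependence on finitely many nodes,
    that the rule is the same at every grid point. *)
Definition local Phi := exists L, forall u0 u1 v0 v1 g h,
  agree L u0 g v0 h -> agree L u1 g v1 h -> Phi u0 u1 g = Phi v0 v1 h.

Lemma agree_le (K L : nat) u g v h :
  (K <= L)%N -> agree L u g v h -> agree K u g v h.
Proof. by move=> KL ag k kK; apply: ag; exact: leq_trans kK KL. Qed.

Lemma agree_shift (L K : nat) (k : int) u g v h :
  (`|k| + K <= L)%N -> agree L u g v h ->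
  agree K u (g + e *~ k) v (h + e *~ k).
Proof.
move=> kL ag j jK; rewrite -!addrA -!mulrzDr; apply: ag; lia.
Qed.

Lemma local_add Phi Psi :
  local Phi -> local Psi -> local (fun u0 u1 g => Phi u0 u1 g + Psi u0 u1 g).
Proof.
move=> [K Phi_loc] [L Psi_loc]; exists (maxn K L) => u0 u1 v0 v1 g h a0 a1.
by congr (_ + _); [apply: Phi_loc | apply: Psi_loc];
  (apply: agree_le; last eassumption); rewrite ?leq_maxl ?leq_maxr.
Qed.

Lemma local_scale (c : R) Phi :
  local Phi -> local (fun u0 u1 g => c * Phi u0 u1 g).
Proof. by move=> [L loc]; exists L => *; congr (_ * _); exact: loc. Qed.

Lemma local_cst (c : R) : local (fun _ _ _ => c).
Proof. by exists 0%N. Qed.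

Lemma local_sum (I : Type) (r : seq I) (Phi : I -> functional) :
  (forall i, local (Phi i)) -> local (fun u0 u1 g => \sum_(i <- r) Phi i u0 u1 g).
Proof.
move=> loc; elim: r => [|i r IHr].
  rewrite (_ : (fun _ => _) = fun _ _ _ => 0); first exact: local_cst.
  by apply/funext => u0; apply/funext => u1; apply/funext => g; rewrite big_nil.
rewrite (_ : (fun _ => _) = fun u0 u1 g =>
  Phi i u0 u1 g + \sum_(j <- r) Phi j u0 u1 g); first exact: local_add.
by apply/funext => u0; apply/funext => u1; apply/funext => g; rewrite big_cons.
Qed.

Lemma local_shift (k : int) Phi :
  local Phi -> local (fun u0 u1 => shift e k (Phi u0 u1)).
Proof.
move=> [L loc]; exists (`|k| + L)%N => u0 u1 v0 v1 g h a0 a1.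
by apply: loc; [apply: agree_shift a0 | apply: agree_shift a1].
Qed.

(** The average at index [k] reads indices [k] and [k + 1], which costs one unit of radius. *)
Lemma agree_mum (L : nat) u g v h :
  agree L.+1 u g v h -> agree L (mum e u) g (mum e v) h.
Proof.
move=> ag k kL; rewrite /mum /shift -!addrA -!mulrzDr.
by rewrite !ag//; lia.
Qed.

Lemma local_mum Phi :
  local Phi -> local (fun u0 u1 => Phi (mum e u0) (mum e u1)).
Proof.
by move=> [L loc]; exists L.+1 => u0 u1 v0 v1 g h a0 a1;
  apply: loc; exact: agree_mum.
Qed.

Lemma local_stencil (f : stencil_function R q) : local (stencil_eval e f).
Proof.
exists (\max_j `|node (s := f) j|)%N => u0 u1 v0 v1 g h a0 a1.
by congr (rule _ _); apply/matrixP => a j; rewrite !mxE /shift ?a0 ?a1//;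
  exact: (leq_bigmax (F := fun j => `|node (s := f) j|%N)).
Qed.

(* The rule picks, classically, any grid functions and grid point that realize
   the given node values; locality makes the value independent of the choice. *)
Lemma stencil_of_local Phi : local Phi ->
  exists f : stencil_function R q, forall u0 u1 g,
    stencil_eval e f u0 u1 g = Phi u0 u1 g.
Proof.
move=> [L loc].
(* The columns cover the indices from [-L] to [L]; index [k] sits in column [k + L]. *)
pose nodes (j : 'I_(L + L).+1) : int := j%:Z - L%:Z.
pose realizes X0 X1 (t : (G -> 'cV[R]_q) * (G -> 'cV[R]_q) * G) :=
  node_values e nodes t.1.1 t.2 = X0 /\ node_values e nodes t.1.2 t.2 = X1.
pose pick X0 X1 := get (realizes X0 X1).
exists (@StencilFunction R q _ nodes (fun X0 X1 =>
  Phi (pick X0 X1).1.1 (pick X0 X1).1.2 (pick X0 X1).2)) => u0 u1 g.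
rewrite /stencil_eval/=; set X0 := node_values _ _ u0 g.
set X1 := node_values _ _ u1 g.
have [e0 e1] : realizes X0 X1 (pick X0 X1).
  by apply: getPex; exists (u0, u1, g).
have agreeP u v h : node_values e nodes u h = node_values e nodes v g ->
    agree L u h v g.
  move=> uv k kL; apply/colP => a.
  have kn : (`|(k + L%:Z)%R| < (L + L).+1)%N by lia.
  have <- : nodes (Ordinal kn) = k by rewrite /nodes/=; lia.
  by move/matrixP: uv => /(_ a (Ordinal kn)); rewrite !mxE.
by apply: loc; exact: agreeP.
Qed.

(** The witness is the sum of S_m^j [Phi] over j < n; the induction step adds the term S_m^n
    [Phi]. *)
Lemma local_telescope_nat (n : nat) Phi : local Phi ->
  exists2 Psi, local Psi & forall u0 u1 g,
    shift e n%:Z (Phi u0 u1) g - Phi u0 u1 g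
    = shift e 1 (Psi u0 u1) g - Psi u0 u1 g.
Proof.
move=> loc; elim: n => [|n [Psi Psi_loc PsiE]].
  exists (fun _ _ _ => 0); first exact: local_cst.
  by move=> u0 u1 g; rewrite /shift mulr0z addr0 !subrr.
exists (fun u0 u1 g => shift e n%:Z (Phi u0 u1) g + Psi u0 u1 g).
  by apply: local_add => //; exact: local_shift.
move=> u0 u1 g; rewrite /shift opprD addrACA -[Psi _ _ _ - _]PsiE.
rewrite addrA subrK /shift; congr (Phi _ _ _ - _).
by rewrite -addrA -mulrzDr -intS.
Qed.

Lemma local_telescope (k : int) Phi : local Phi ->
  exists2 Psi, local Psi & forall u0 u1 g,
    shift e k (Phi u0 u1) g - Phi u0 u1 g
    = shift e 1 (Psi u0 u1) g - Psi u0 u1 g.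
Proof.
case: k => n loc; first exact: local_telescope_nat.
rewrite NegzE.
(* With k = n + 1, S_m^(-k) - I = -(S_m^k - I) S_m^(-k): the nonnegative case applies to the
   functional already shifted back, and the sign flips. *)
have [Psi Psi_loc PsiE] := local_telescope_nat n.+1
  (local_shift (- n.+1%:Z) loc).
exists (fun u0 u1 g => -1 * Psi u0 u1 g); first exact: local_scale.
move=> u0 u1 g; move: (PsiE u0 u1 g); rewrite /shift -addrA -mulrzDr subrr.
by rewrite mulr0z addr0 !mulN1r -opprD => <-; rewrite opprB.
Qed.

Lemma local_telescope_sum (I : finType) (Phi : I -> functional) (k : I -> int) :
  (forall i, local (Phi i)) ->
  exists2 Psi, local Psi & forall u0 u1 g,
    \sum_i shift e (k i) (Phi i u0 u1) g
    = \sum_i Phi i u0 u1 g + (shift e 1 (Psi u0 u1) g - Psi u0 u1 g).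
Proof.
move=> loc.
have /choice[Psi PsiP] i : exists Psi, local Psi /\ forall u0 u1 g,
    shift e (k i) (Phi i u0 u1) g - Phi i u0 u1 g
    = shift e 1 (Psi u0 u1) g - Psi u0 u1 g.
  by have [Psi ? ?] := local_telescope (k i) (loc i); exists Psi.
exists (fun u0 u1 g => \sum_i Psi i u0 u1 g).
  by apply: local_sum => i; case: (PsiP i).
move=> u0 u1 g; rewrite /shift -sumrB -big_split/=; apply: eq_bigr => i _.
by case: (PsiP i) => _ <-; rewrite addrC subrK.
Qed.

End Local.

(** * Energy increment at a grid point, up to a spatial difference *)

Section EnergyBalance.
Variables (R : realType) (G : zmodType) (e : G) (q N : nat) (A : int).
Variable H : 'M[R]_(q, N) -> R.
Hypothesis H_C1 : continuously_differentiable H.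
Local Notation mu := (@lebesgue_measure R).

Definition mean_partial (a : 'I_q) (i : 'I_N) (v0 v1 : G -> 'cV[R]_q) (g : G) :=
  \int[mu]_(x in `[0, 1]) partial H a i (window e A N (segment v0 v1 x) g).

Lemma window_segment v0 v1 x g : window e A N (segment v0 v1 x) g
  = (1 - x) *: window e A N v0 g + x *: window e A N v1 g :> 'M[R]_(q, N).
Proof. by apply/matrixP => a i; rewrite !mxE. Qed.

(** A shift moves only the base point, so it passes through the integral over the segment;
    continuity in [x] lets the finite sum out. *)
Lemma delta_oddE v0 v1 g a : delta_odd e A H v0 v1 g a 0
  = \sum_(i < N) shift e (- (A + i%:Z)) (mean_partial a i v0 v1) g.
Proof.
rewrite mxE; under eq_Rintegral do rewrite mxE.
rewrite Rintegral01_sum// => i x; rewrite /shift.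
under [X in continuous_at _ X]eq_fun do rewrite window_segment.
exact: continuous_partial_line.
Qed.

Lemma local_mean_partial a i : local e (mean_partial a i).
Proof.
exists (\max_(j < N) `|(A + j%:Z)%R|)%N => u0 u1 v0 v1 g h a0 a1.
apply: eq_Rintegral => x _; congr partial; apply/matrixP => b j.
have jL := leq_bigmax (F := fun j : 'I_N => `|(A + j%:Z)%R|%N) j.
by rewrite !mxE /shift /segment a0// a1.
Qed.

(** The share of component [a] and stencil position [i] in delta^T (v1 - v0). Its shift by [A + i]
    is the corresponding term in the increment of [H]. *)
Definition power (a : 'I_q) (i : 'I_N) (v0 v1 : G -> 'cV[R]_q) (g : G) :=
  (v1 g a 0 - v0 g a 0) * shift e (- (A + i%:Z)) (mean_partial a i v0 v1) g.

Lemma local_power a i : local e (power a i).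
Proof.
have [L loc] := local_shift (- (A + i%:Z)) (local_mean_partial a i).
exists L => u0 u1 v0 v1 g h a0 a1; rewrite /power.
(* Index [0] lies within every radius, so the radius of the shifted mean also covers the increment
   at the base point. *)
have -> : u0 g = v0 h by have := a0 0 (leq0n _); rewrite mulr0z !addr0.
have -> : u1 g = v1 h by have := a1 0 (leq0n _); rewrite mulr0z !addr0.
have {}loc := loc _ _ _ _ _ _ a0 a1.
exact: congr1 loc.
Qed.

Lemma energy_balance : exists2 Psi, local e Psi & forall v0 v1 g,
  H (window e A N v1 g) - H (window e A N v0 g)
  = ((delta_odd e A H v0 v1 g)^T *m (v1 g - v0 g)) 0 0
    + (shift e 1 (Psi v0 v1) g - Psi v0 v1 g).
Proof.
have [Psi Psi_loc PsiE] := local_telescope_sum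
  (Phi := fun p : 'I_q * 'I_N => power p.1 p.2) (fun p => A + p.2%:Z)
  (fun p => local_power p.1 p.2).
exists Psi => // v0 v1 g.
(* The forward shift cancels the backward one on the mean partial derivative and moves the increment
   to the node [A + i]. *)
transitivity (\sum_(p : 'I_q * 'I_N) shift e (A + p.2%:Z) (power p.1 p.2 v0 v1) g).
  rewrite (partial_line_integral _ _ H_C1) pair_bigA/=; apply: eq_bigr => -[a i] _ /=.
  rewrite !mxE /shift /power /shift -addrA -mulrzDr subrr mulr0z addr0.
  by apply: congr1; apply: eq_Rintegral => x _; rewrite window_segment.
rewrite PsiE; congr (_ + _); rewrite mxE -(pair_bigA _ (fun a i => power a i v0 v1 g))/=.
apply: eq_bigr => a _; rewrite mxE delta_oddE mulr_suml.
by apply: eq_bigr => i _; rewrite /power mulrC !mxE.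
Qed.

End EnergyBalance.

(** * Common treatment of the odd and even stencils *)

Lemma mum_segment (R : realType) (G : zmodType) (e : G) (q : nat)
    (u0 u1 : G -> 'cV[R]_q) (x : R) :
  mum e (segment u0 u1 x) = segment (mum e u0) (mum e u1) x.
Proof.
apply/funext => g; apply/colP => a; rewrite /segment /mum /shift !mxE; ring.
Qed.

Lemma delta_evenE (R : realType) (G : zmodType) (e : G) (q N : nat) (A : int)
    (H : 'M[R]_(q, N) -> R) (u0 u1 : G -> 'cV[R]_q) :
  delta_even e A H u0 u1 = delta_odd e A H (mum e u0) (mum e u1).
Proof.
apply/funext => g; apply/colP => a; rewrite [LHS]mxE [RHS]mxE.
by apply: eq_Rintegral => x _; rewrite mum_segment.
Qed.

(** [T] stands for the identity on an odd stencil and for [mum e] on an even one; both keep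
    functionals local under precomposition. *)
Lemma avf_conservation (R : realType) (G : zmodType) (e : G) (dx dt : R)
    (q N : nat) (A : int) (H : 'M[R]_(q, N) -> R)
    (T : (G -> 'cV[R]_q) -> (G -> 'cV[R]_q))
    (D : (G -> 'cV[R]_q) -> (G -> 'cV[R]_q) -> operator_matrix R G q)
    (f : stencil_function R q) :
  dx != 0 -> continuously_differentiable H ->
  (forall Phi, local e Phi -> local e (fun u0 u1 => Phi (T u0) (T u1))) ->
  (forall u0 u1 g, quad_op (D u0 u1) (delta_odd e A H (T u0) (T u1)) g
     = Dm e dx (stencil_eval e f u0 u1) g) ->
  exists F : stencil_function R q, forall u0 u1,
    (forall g, Dn dt (T u0) (T u1) g
       = apply_op (D u0 u1) (delta_odd e A H (T u0) (T u1)) g) ->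
    forall g, Dn dt (fun g' => H (window e A N (T u0) g'))
                    (fun g' => H (window e A N (T u1) g')) g
      = Dm e dx (stencil_eval e F u0 u1) g.
Proof.
move=> dx0 H_C1 T_loc fE; have [Psi Psi_loc PsiE] := energy_balance e A H_C1.
(* The flux is [f + (dx / dt) * Psi]: the factor [dx] cancels the division in [Dm], and [1 / dt]
   comes from [Dn]. *)
have [F FE] := stencil_of_local (local_add (local_stencil e f)
  (local_scale (dx / dt) (T_loc _ Psi_loc))).
exists F => u0 u1 sol g.
have -> : Dm e dx (stencil_eval e F u0 u1) g = Dm e dx (stencil_eval e f u0 u1) g
    + dt^-1 * (shift e 1 (Psi (T u0) (T u1)) g - Psi (T u0) (T u1) g).
  by rewrite /Dm /shift !FE; move: dt^-1 => c; field.
rewrite /Dn PsiE scalerDr; congr (_ + _).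
(* The equation of the method enters here, replacing [apply_op] by the time difference inside the
   quadratic form. *)
by rewrite -fE /quad_op -sol /Dn -scalemxAr [RHS]mxE.
Qed.

Theorem theorem3 (R : realType) (G : zmodType) (e : G) (dx dt : R) (q : nat)
    (A B : int) (M : nat)
    (D : (G -> 'cV[R]_q) -> (G -> 'cV[R]_q) -> operator_matrix R G q) :
  uniform_grid e -> 0 < dx -> 0 < dt -> (0 < q)%N ->
  A <= B -> M%:Z = B - A + 1 ->
  (odd M -> A = - B ->
   forall H : 'M[R]_(q, M) -> R,
   continuously_differentiable H ->
   (exists f : stencil_function R q,
      forall (u0 u1 : G -> 'cV[R]_q) (g : G),
        quad_op (D u0 u1) (delta_odd e A H u0 u1) g
        = Dm e dx (stencil_eval e f u0 u1) g) ->
   exists F : stencil_function R q,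
     forall u0 u1 : G -> 'cV[R]_q,
       (forall g : G,
          Dn dt u0 u1 g = apply_op (D u0 u1) (delta_odd e A H u0 u1) g) ->
       forall g : G,
         Dn dt (fun g' => H (window e A M u0 g'))
               (fun g' => H (window e A M u1 g')) g
         = Dm e dx (stencil_eval e F u0 u1) g)
  /\
  (~~ odd M -> A = 1 - B ->
   forall H : 'M[R]_(q, M.-1) -> R,
   continuously_differentiable H ->
   (exists f : stencil_function R q,
      forall (u0 u1 : G -> 'cV[R]_q) (g : G),
        quad_op (D u0 u1) (delta_even e A H u0 u1) g
        = Dm e dx (stencil_eval e f u0 u1) g) ->
   exists F : stencil_function R q,
     forall u0 u1 : G -> 'cV[R]_q,
       (forall g : G,
          Dn dt (mum e u0) (mum e u1) g
          = apply_op (D u0 u1) (delta_even e A H u0 u1) g) ->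
       forall g : G,
         Dn dt (fun g' => H (window e A M.-1 (mum e u0) g'))
               (fun g' => H (window e A M.-1 (mum e u1) g')) g
         = Dm e dx (stencil_eval e F u0 u1) g).
Proof.
move=> _ dx_gt0 _ _ _ _; have dx0 := lt0r_neq0 dx_gt0; split=> _ _ H H_C1 [f fE].
  exact: (@avf_conservation _ _ _ _ _ _ _ _ _ id _ f).
have [||F FE] := @avf_conservation _ _ e dx dt _ _ A H (@mum R G e _) D f dx0 H_C1.
- exact: local_mum.
- by move=> u0 u1 g; rewrite -delta_evenE.
- by exists F => u0 u1 sol; apply: FE => g; rewrite sol delta_evenE.
Qed.
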